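(* For any trees $T_1$ and $T_2$ we have $$\mathrm{diam}_{\min}(T_1\boxtimes T_2)\le \max\{\mathrm{diam}(T_1),\mathrm{diam}(T_2)\}+15 .$$
   Context: Graphs are finite, simple and undirected. The strong product $G\boxtimes H$ of graphs $G$ and $H$ has vertex set $V(G)\times V(H)$; vertices $(x_1,y_1)$ and $(x_2,y_2)$ are adjacent iff $x_1=x_2$ and $y_1y_2\in E(H)$, or $x_1x_2\in E(G)$ and $y_1=y_2$, or $x_1x_2\in E(G)$ and $y_1y_2\in E(H)$. An orientation of a graph $G$ is a digraph obtained by giving each edge of $G$ exactly one of its two directions. A digraph $D$ is strongly connected (strong) if for all vertices $u,v$ there is a directed path from $u$ to $v$. The distance $\mathrm{dist}(u,v)$ in $D$ is the length (number of arcs) of a shortest directed path from $u$ to $v$ ($\infty$ if none exists), and $\mathrm{diam}(D)=\max\{\mathrm{dist}(u,v) : u,v\in V(D)\}$. For an undirected graph, $\mathrm{diam}$ is the usual diameter. For an undirected graph $G$, $\mathrm{diam}_{\min}(G)=\min\{\mathrm{diam}(D) : D \text{ is a strong orientation of } G\}$.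
   Formalization: The case where exactly one of the two trees is a single vertex is excluded, since then the strong product is a nontrivial tree, which has no strong orientation, and diam_min is undefined. *)

(* Defs.v *)
From mathcomp Require Import all_boot.

Set Implicit Arguments.
Unset Strict Implicit.
Unset Printing Implicit Defensive.

Record sgraph := SGraph {
  vertex :> finType;
  adj : rel vertex;
  adj_sym : symmetric adj;
  adj_irr : irreflexive adj
}.

(* Elements of the extended naturals are of type [option nat]; None is
   infinity. *)
Definition ole (a b : option nat) : bool :=
  match a, b with
  | _, None => true
  | None, Some _ => false
  | Some m, Some n => m <= n
  end.

Definition omax (a b : option nat) : option nat :=
  match a, b with
  | Some m, Some n => Some (maxn m n)
  | _, _ => None
  end.

Definition omin (a b : option nat) : option nat :=
  match a, b with
  | None, _ => b
  | _, None => a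
  | Some m, Some n => Some (minn m n)
  end.

Definition oaddn (a : option nat) (k : nat) : option nat :=
  omap (fun m => m + k) a.

(* A relation d is read as the digraph with an arc from x to y when d x y;
   the definitions also apply to undirected graphs, seen as symmetric
   relations. *)
Section Digraph.

Variables (V : finType) (d : rel V).

(* The size of p counts arcs, since the path is u :: p. *)
Definition has_dipath (u v : V) (n : nat) : bool :=
  [exists p : n.-tuple V, [&& path d u p, uniq (u :: p) & last u p == v]].

Lemma has_dipath_connect u v : connect d u v -> exists n, has_dipath u v n.
Proof.
case/connectP=> p dp ->; case/shortenP: dp => q dq uq _.
exists (size q); apply/existsP; exists (in_tuple q).
by rewrite dq eqxx andbT /=.
Qed.

Definition dist (u v : V) : option nat :=
  if @idP (connect d u v) is ReflectT duv
  then Some (ex_minn (has_dipath_connect duv)) else None.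

Definition rdiam : option nat :=
  \big[omax/Some 0]_(u : V) \big[omax/Some 0]_(v : V) dist u v.

Definition strongly_connected : bool :=
  [forall u : V, forall v : V, connect d u v].

End Digraph.

Definition diam (G : sgraph) : option nat := rdiam (@adj G).

Definition arc (V : finType) (D : {set V * V}) : rel V :=
  fun x y => (x, y) \in D.

(* For non-adjacent x, y neither pair is an arc; for adjacent ones, exactly
   one is. *)
Definition orientation (G : sgraph) (D : {set G * G}) : bool :=
  [forall x : G, forall y : G,
     if adj x y then arc D x y (+) arc D y x else ~~ arc D x y].

(* The minimum is None when G has no strong orientation, i.e., when G is
   disconnected or has a bridge. *)
Definition diam_min (G : sgraph) : option nat :=
  \big[omin/None]_(D : {set G * G}
                   | orientation D && strongly_connected (arc D))
     rdiam (arc D).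

Definition is_tree (G : sgraph) : Prop :=
  [/\ 0 < #|G|,
      forall x y : G, connect (@adj G) x y
    & forall c : seq G, 2 < size c -> ~ ucycle (@adj G) c].

Section StrongProduct.

Variables G H : sgraph.

Definition strong_adj : rel (G * H) := fun p q =>
  [|| (p.1 == q.1) && adj p.2 q.2,
      adj p.1 q.1 && (p.2 == q.2)
    | adj p.1 q.1 && adj p.2 q.2].

Lemma strong_adj_sym : symmetric strong_adj.
Proof.
move=> p q; rewrite /strong_adj (eq_sym q.1) (eq_sym q.2).
by rewrite (adj_sym q.1) (adj_sym q.2).
Qed.

Lemma strong_adj_irr : irreflexive strong_adj.
Proof. by move=> p; rewrite /strong_adj !adj_irr !andbF. Qed.

Definition strong_product : sgraph := SGraph strong_adj_sym strong_adj_irr.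

End StrongProduct.

(* Main.v *)
(* Root both trees and call a vertex (x, y) of the product odd when the sum of
   the depths of x and y is odd. Orient a diagonal edge upwards in T2 if its
   ends are odd, and downwards in T2 otherwise; an edge inside a copy of T1
   upwards if it lies over a vertex of T2 of odd depth, and downwards
   otherwise. Cover T1 by stars with centres above their leaves (possible if the
   root is adjacent to a leaf of T1), and orient the copies of T2 from odd to
   even depth over a centre and from even to odd depth over a star leaf. Then
   an edge of a star times an edge of T2 is a directed 4-cycle, so local
   corrections cost at most 3 steps.
     To go from an odd (x, y) to an even (x', y'), climb diagonally in T2 to a
   vertex of odd depth near the meeting point of y and y', moving freely towards
   x' in T1; then go up in T1, pass to a vertex of even depth in T2 by a
   4-cycle, go down in T1, and finally descend diagonally in T2. The numbers of
   steps in T1 and T2 have equal parity, so that the T1-walk can be padded by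
   bouncing if it is too short. The parities of the ends are adjusted by a
   4-cycle at the start and another one at the end. *)

Require Import Defs.
From mathcomp Require Import all_boot zify.

Set Implicit Arguments.
Unset Strict Implicit.
Unset Printing Implicit Defensive.

(** * Walks of bounded length, distance and diameter *)

Section Walks.

Variables (V : finType) (e : rel V).

Fixpoint walk (n : nat) (x y : V) : Prop :=
  if n is n'.+1 then exists2 z, e x z & walk n' z y else x = y.

Definition reach (n : nat) (x y : V) : Prop := exists2 m, m <= n & walk m x y.

Lemma walk_cat m n x y z : walk m x y -> walk n y z -> walk (m + n) x z.
Proof.
elim: m x => [|m IH] x /= => [->//|[t xt ty] yz].
by exists t => //; apply: IH ty yz.
Qed.

Lemma walkSr n x y z : walk n x y -> e y z -> walk n.+1 x z.
Proof. by move=> xy yz; rewrite -addn1; apply: walk_cat xy _; exists z. Qed.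

Lemma walk_sym n x y : symmetric e -> walk n x y -> walk n y x.
Proof.
move=> se; elim: n x => [|n IH] x /= => [->//|[t xt ty]].
by apply: walkSr (IH _ ty) _; rewrite se.
Qed.

Lemma walkP n x y :
  walk n x y <-> exists p, [/\ path e x p, last x p = y & size p = n].
Proof.
split=> [|[p [+ + <-]]].
  elim: n x => [|n IH] x /= => [->|[t xt /IH[p [ep lp sp]]]].
    by exists [::].
  by exists (t :: p); rewrite /= xt sp.
elim: p x => [|t p IH] x //= /andP[xt tp] lp.
by exists t => //; apply: IH.
Qed.

Lemma reach_trans m n x y z : reach m x y -> reach n y z -> reach (m + n) x z.
Proof.
case=> i im xy [j jn yz]; exists (i + j); first exact: leq_add.
exact: walk_cat xy yz.
Qed.

Lemma reach_leq m n x y : m <= n -> reach m x y -> reach n x y.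
Proof. by move=> mn [i im w]; exists i => //; apply: leq_trans mn. Qed.

Lemma reach1 x y : e x y -> reach 1 x y.
Proof. by move=> xy; exists 1 => //; exists y. Qed.

Lemma reach_connect n x y : reach n x y -> connect e x y.
Proof. by case=> m _ /walkP[p [ep <- _]]; apply/connectP; exists p. Qed.

(** Shortening a walk to a simple path does not lengthen it, so arbitrary walks suffice to bound
    distances. *)
Lemma dist_reach n x y : ole (dist e x y) (Some n) <-> reach n x y.
Proof.
split.
  rewrite /dist; case: {-}_ / idP => // xy /=; case: ex_minnP => m.
  case/existsP=> p /and3P[ep _ /eqP lp] _ mn; exists m => //.
  by apply/walkP; exists p; rewrite size_tuple.
move=> r; have xy := reach_connect r; case: r => m mn /walkP[p [ep lp sp]].
rewrite /dist; case: {-}_ / idP => // c /=; case: ex_minnP => k _ kmin.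
apply: leq_trans mn; rewrite -sp -lp in kmin *.
case: {lp c xy y sp} (shortenP ep) kmin => q eq' uq qp.
set y := last x q => kmin.
apply: leq_trans (kmin (size q) _) _.
  by apply/existsP; exists (in_tuple q); rewrite eq' uq /y eqxx.
by apply: uniq_leq_size; [case/andP: uq | exact: qp].
Qed.

Lemma ole_bigomax (I : finType) (F : I -> option nat) c :
  ole (\big[omax/Some 0]_i F i) c <-> forall i, ole (F i) c.
Proof.
have omaxP a b d : ole (omax a b) d = ole a d && ole b d.
  by case: a b d => [a|] [b|] [d|] //=; rewrite ?geq_max ?andbF ?andbT.
have -> : ole (\big[omax/Some 0]_i F i) c = \big[andb/true]_i ole (F i) c.
  by apply: (big_morph (fun a => ole a c)) => [a b|]; [exact: omaxP | case: c].
by rewrite big_andE; split=> [/forallP|h]; [|apply/forallP].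
Qed.

Lemma ole_rdiam c : ole (rdiam e) c <-> forall x y, ole (dist e x y) c.
Proof.
split=> [/ole_bigomax h x y | h].
  by have /ole_bigomax := h x; apply.
by apply/ole_bigomax => x; apply/ole_bigomax => y; apply: h.
Qed.

Lemma rdiam_reach n : ole (rdiam e) (Some n) <-> forall x y, reach n x y.
Proof.
rewrite ole_rdiam; split=> h x y; first exact/dist_reach.
by apply/dist_reach.
Qed.

End Walks.

Lemma diam_min_reach (G : sgraph) (A : rel G) n :
    (forall x y, if adj x y then A x y (+) A y x else ~~ A x y) ->
    (forall x y, reach A n x y) ->
  ole (diam_min G) (Some n).
Proof.
move=> oA rA; pose D := [set p : G * G | A p.1 p.2].
have arcD : Defs.arc D =2 A by move=> x y; rewrite /Defs.arc /D inE.
have rD x y : reach (Defs.arc D) n x y.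
  have [m mn /walkP[p [Ap lp sp]]] := rA x y; exists m => //.
  by apply/walkP; exists p; rewrite (eq_path arcD).
have oD : orientation D && strongly_connected (Defs.arc D).
  apply/andP; split; apply/forallP=> x; apply/forallP=> y; rewrite ?arcD.
    exact: oA.
  exact: reach_connect (rD x y).
have leD : ole (rdiam (Defs.arc D)) (Some n) by apply/rdiam_reach.
rewrite /diam_min; elim: (index_enum _) (mem_index_enum D) => // E s IH.
rewrite inE big_cons; case: eqP => [<- _|_ /IH]; first rewrite oD.
  move: leD; case: (rdiam _) => //= m.
  case: (\big[_/_]_(_ <- _ | _) _) => //= k.
  by rewrite geq_min => ->.
case: ifP => // _; case: (\big[_/_]_(_ <- _ | _) _) => //= k kn.
by case: (rdiam _) => //= m; rewrite geq_min kn orbT.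
Qed.

(** * Rooted trees and meeting points *)

Record rooting (T : sgraph) := Rooting {
  root : T;
  par : T -> T;
  depth : T -> nat;
  depth_root : depth root = 0;
  depth_par : forall x, x != root -> depth x = (depth (par x)).+1;
  adj_par : forall x y,
    adj x y = (x != root) && (par x == y) || (y != root) && (par y == x)
}.

(* An edge xy outside e would close a simple e-path from x to y to a cycle. *)
Lemma tree_edge (T : sgraph) (e : rel T) : is_tree T ->
    subrel e (@adj T) -> (forall x y, connect e x y) ->
  forall x y, adj x y -> e x y.
Proof.
case=> _ _ acyc eadj ce x y xy; have /connectP[p0 ep0 ly0] := ce x y.
move: ly0; case: (shortenP ep0) => p ep up _ {p0 ep0} ly.
case: p => [|z [|t p]] in ep up ly *.
- by rewrite ly /= adj_irr in xy.
- by move: ep; rewrite /= andbT ly.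
- case: (acyc [:: x, z, t & p] isT); apply/andP; split=> //.
  rewrite (cycle_path x) /= -[last t p]/(last x [:: z, t & p]) -ly adj_sym xy.
  exact: sub_path ep.
Qed.

(** Depth is the distance from [r], and a parent is any neighbour one level higher. The parent edges
    alone connect the tree, so by [tree_edge] there are no others. *)
Lemma tree_rooting (T : sgraph) (r : T) :
  is_tree T -> exists R : rooting T, root R = r.
Proof.
move=> tT; have [_ cT _] := tT.
have wr x : exists n, has_dipath (@adj T) r x n.
  exact/has_dipath_connect/cT.
pose dp x := ex_minn (wr x).
have dpP x n : walk (@adj T) n r x -> dp x <= n.
  move=> w; have /dist_reach : reach (@adj T) n r x by exists n.
  rewrite /dist; case: {-}_ / idP => // c /=; rewrite /dp.
  case: ex_minnP => k kP _; case: ex_minnP => m _ mmin; apply: leq_trans.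
  exact: mmin.
have dp_walk x : walk (@adj T) (dp x) r x.
  rewrite /dp; case: ex_minnP => n /existsP[p /and3P[ep _ /eqP lp]] _.
  by apply/walkP; exists p; rewrite size_tuple.
have dpr : dp r = 0 by apply/eqP; rewrite -leqn0; apply: dpP.
have parP x : exists y, (x != r) ==> adj x y && (dp x == (dp y).+1).
  case: eqP => [|/eqP xr]; first by exists x.
  have /walkP[p [ep lp sp]] := dp_walk x.
  case/lastP: p => [|p z] in ep lp sp; first by rewrite -lp eqxx in xr.
  move: ep lp sp; rewrite rcons_path last_rcons size_rcons.
  move=> /andP[ep pz] zx sp.
  rewrite {z}zx in pz; exists (last r p); rewrite adj_sym pz /= eqn_leq -{2}sp.
  apply/andP; split; first by apply: dpP; apply: walkSr pz.
  by rewrite ltnS; apply: dpP; apply/walkP; exists p.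
pose pr x := xchoose (parP x).
have prP x : x != r -> adj x (pr x) /\ dp x = (dp (pr x)).+1.
  by move=> xr; have /implyP/(_ xr)/andP[-> /eqP] := xchooseP (parP x).
pose e x y := (x != r) && (pr x == y) || (y != r) && (pr y == x).
have sube : subrel e (@adj T).
  move=> x y /orP[] /andP[/prP[+ _] /eqP <-] //.
  by rewrite adj_sym.
have cr x : connect e x r.
  have [n] := ubnP (dp x); elim: n x => // n IH x.
  have [-> //|xr] := eqVneq x r; have [_ ->] := prP x xr; rewrite ltnS => /IH.
  by apply: connect_trans; apply: connect1; rewrite /e xr eqxx.
have se : symmetric e by move=> x y; rewrite /e orbC.
have ce x y : connect e x y.
  by apply: connect_trans (cr x) _; rewrite (sym_connect_sym se).
have adjE x y : adj x y = e x y.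
  by apply/idP/idP; [exact: tree_edge | exact: sube].
by exists (Rooting dpr (fun x xr => (prP x xr).2) adjE).
Qed.

Section Rooting.

Variables (T : sgraph) (R : rooting T).

Definition up : rel T := fun x y => (x != root R) && (par R x == y).

Lemma adj_up x y : adj x y = up x y || up y x.
Proof. exact: adj_par. Qed.

Lemma upP x y : up x y -> depth R x = (depth R y).+1.
Proof. by case/andP=> /depth_par-> /eqP->. Qed.

Lemma up_spec x y : up x y ->
  [/\ x != root R, par R x = y & depth R x = (depth R y).+1].
Proof. by move=> xy; rewrite (upP xy); case/andP: xy => ? /eqP. Qed.

Lemma up_asym x y : up x y -> up y x = false.
Proof. by move/upP=> xy; apply/negP=> /upP; lia. Qed.

Lemma odd_adj x y : adj x y -> odd (depth R y) = ~~ odd (depth R x).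
Proof. by rewrite adj_up => /orP[] /upP->; rewrite /= ?negbK. Qed.

Lemma depth_gt0 x : (0 < depth R x) = (x != root R).
Proof.
by have [->|/depth_par->] := eqVneq x (root R); rewrite ?depth_root.
Qed.

Lemma up_par x : x != root R -> up x (par R x).
Proof. by rewrite /up eqxx andbT. Qed.

Lemma adj_par_l x : x != root R -> adj x (par R x).
Proof. by rewrite adj_up => /up_par->. Qed.

Lemma depth_iter_par k x :
  k <= depth R x -> depth R (iter k (par R) x) = depth R x - k.
Proof.
elim: k => [|k IH] kx; first by rewrite subn0.
have := IH (ltnW kx); have : iter k (par R) x != root R.
  by rewrite -depth_gt0 (IH (ltnW kx)) subn_gt0.
by move/depth_par=> /= -> /=; lia.
Qed.

Lemma iter_par_nroot k x : k < depth R x -> iter k (par R) x != root R.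
Proof.
by move=> kx; rewrite -depth_gt0 (depth_iter_par (ltnW kx)) subn_gt0.
Qed.

(* The common ancestor need not be the lowest one, so i + j may exceed the
   distance of x and y. *)
Definition meet i j x y : Prop :=
  [/\ i <= depth R x, j <= depth R y & iter i (par R) x = iter j (par R) y].

Lemma meet_sym i j x y : meet i j x y -> meet j i y x.
Proof. by case=> *; split. Qed.

(** Prepending a step up increments [i]; prepending a step down decrements [i] or, if [i] is 0,
    increments [j]. *)
Lemma walk_meet n x y :
  walk (@adj T) n x y -> exists i j, i + j <= n /\ meet i j x y.
Proof.
elim: n x => [|n IH] x /= => [->|[z xz /IH[i [j [ijn [iz jy ij]]]]]].
  by exists 0, 0.
move: xz; rewrite adj_up => /orP[] /up_spec[rz pz dz].
  exists i.+1, j; split; first by lia.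
  by split; rewrite // ?dz // iterSr pz.
case: i => [|i] in ijn iz ij *.
  exists 0, j.+1; split; first by lia.
  split=> //; last by rewrite iterS -ij /= pz.
  by have := depth_iter_par jy; rewrite -ij /= dz; lia.
exists i, j; split; first by lia.
by split=> //; [lia | rewrite -ij iterSr pz].
Qed.

Lemma meet_odd i j x y :
  meet i j x y -> odd (i + j) = odd (depth R x) (+) odd (depth R y).
Proof.
by case=> ix jy /(congr1 (depth R)); rewrite !depth_iter_par // -oddD; lia.
Qed.

Hypothesis nbrs : forall x : T, exists y, adj x y.

(** If [i] and [j] are both 0, the step bounces to some neighbour, whence the [1] in the bound. *)
Lemma meet_step i j x y : meet i j x y ->
  exists z i' j', [/\ adj x z, meet i' j' z y & i' + j' <= maxn (i + j).-1 1].
Proof.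
case=> ix jy ij; case: i => [|i] in ix ij *.
  case: j => [|j] in jy ij *.
    have [z xz] := nbrs x; exists z; rewrite /= in ij; subst y.
    have [/up_spec[rz pz dz]|/up_spec[rz pz dz]] : up x z \/ up z x.
    - by apply/orP; rewrite -adj_up.
    - by exists 0, 1; split=> //; split=> //; rewrite ?pz ?dz.
    - by exists 1, 0; split=> //; split=> //; rewrite ?pz ?dz.
  exists (iter j (par R) y), 0, j; split; last by lia.
    rewrite adj_sym [x]ij iterS; apply/adj_par_l/iter_par_nroot; lia.
  by split=> //; lia.
exists (par R x), i, j; split; last by lia.
  by apply: adj_par_l; rewrite -depth_gt0; lia.
split=> //; last by rewrite -ij iterSr.
by have := @depth_par _ R x; rewrite -depth_gt0; lia.
Qed.

Lemma meet_walk k i j x y : meet i j x y ->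
  exists z i' j', [/\ walk (@adj T) k x z, meet i' j' z y
                    & i' + j' <= maxn (i + j - k) 1].
Proof.
elim: k => [|k IH] in i j x * => m; first by exists x, i, j; split=> //; lia.
have [x1 [i1 [j1 [xx1 m1 l1]]]] := meet_step m.
have [z [i' [j' [w m' l']]]] := IH _ _ _ m1.
by exists z, i', j'; split=> //; [exists x1 | lia].
Qed.

(* The walks towards the meeting point bounce along an edge once they reach
   it, whence the parity condition. *)
Lemma meet_split a b i j x y : meet i j x y -> odd (a + b) = odd (i + j) ->
  exists u v k l, [/\ walk (@adj T) a x u, walk (@adj T) b v y, meet k l u v
                    & a + b + (k + l) <= maxn (i + j) (a + b)].
Proof.
move=> m oab; have [u [i1 [j1 [wu m1 l1]]]] := meet_walk a m.
have [v [l [k [wv m2 l2]]]] := meet_walk b (meet_sym m1).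
have := conj (meet_odd m) (meet_odd (meet_sym m2)).
have odd_walk n s t : walk (@adj T) n s t ->
    odd (depth R t) = odd n (+) odd (depth R s).
  elim: n s => [|n IH] s /= => [->//|[w sw /IH->]].
  by rewrite (odd_adj sw); case: (odd _); case: (odd _).
have := conj (odd_walk _ _ _ wu) (odd_walk _ _ _ wv).
move=> [-> ->] [o1 o2]; exists u, v, k, l; split=> //.
- by apply: walk_sym wv; exact: adj_sym.
- exact: meet_sym.
(* Long walks leave [l + k <= 1], which evenness turns into 0. *)
have olk : ~~ odd (l + k).
  by rewrite addnC o2; move: oab; rewrite o1 oddD; do 4!case: (odd _).
have oabij : ~~ odd (a + b + (i + j)) by rewrite oddD oab addbb.
move: l1 l2 (even_halfK olk) (even_halfK oabij); move: (half (l + k)) (half _).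
by clear => *; lia.
Qed.

End Rooting.

(** * Leaves and star covers *)

Lemma tree_nbr (T : sgraph) (x : T) :
  is_tree T -> 1 < #|T| -> exists y, adj x y.
Proof.
case=> _ cT _ /card_gt1P[a [b [_ _ ab]]].
have [y yx] : exists y, y != x.
  by have [ax|] := eqVneq a x; [exists b; rewrite -ax eq_sym | exists a].
have /connectP[[|z p] /= ep ly] := cT x y; first by rewrite ly eqxx in yx.
by exists z; case/andP: ep.
Qed.

(** A deepest vertex has no child, so its parent is its only neighbour. *)
Lemma tree_leaf (T : sgraph) : is_tree T -> 1 < #|T| ->
  exists2 l : T, exists y, adj l y & forall y z, adj l y -> adj l z -> y = z.
Proof.
move=> tT T1; have /card_gt0P[r _] := ltnW T1.
have [R _] := tree_rooting r tT.
case: (@arg_maxnP _ r predT (depth R)) => // l _ lmax.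
have up_l y : adj l y -> par R l = y.
  rewrite (adj_up R) => /orP[] /up_spec[_ py dy] //.
  by have /= := lmax y isT; rewrite dy ltnn.
exists l; first exact: tree_nbr.
by move=> y z /up_l <- /up_l <-.
Qed.

Section Stars.

Variables (T : sgraph) (R : rooting T).

(** The condition at [x] involves only vertices one level deeper, so [L] is built level by level
    from the bottom. *)
Lemma up_kernel :
  exists L : pred T, forall x, L x = [forall y, up R y x ==> ~~ L y].
Proof.
pose N := (\max_x depth R x).+1.
have ltN x : depth R x < N by rewrite ltnS; apply: leq_bigmax.
suff [L LP] : exists L : pred T, forall x, N - N <= depth R x ->
    L x = [forall y, up R y x ==> ~~ L y].
  by exists L => x; rewrite LP ?subnn.
(* After [k] rounds the [k] deepest levels are settled. *)
elim: {2}N => [|k [L LP]].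
  by exists predT => x; rewrite subn0 leqNgt ltN.
pose F x := [forall y, up R y x ==> ~~ L y].
exists (fun x => if depth R x < N - k then F x else L x) => x Nx.
have -> : (if depth R x < N - k then F x else L x) = F x.
  by case: ltnP => // /LP.
apply: eq_forallb => y; apply: implyb_id2l => /upP dy.
by rewrite ifF // dy ltnNge; apply/negbF; lia.
Qed.

(* The vertices of L are the leaves of the stars; their centres lie above them,
   outside L. *)
Definition star (L : pred T) (u l : T) := [&& up R l u, L l & ~~ L u].

(** A vertex of [L] is joined to its parent, any other one to a child in [L]. The root has no
    parent, so it must lie outside [L], which its childless child [l] ensures. *)
Lemma star_cover : (exists2 l, up R l (root R) & forall y, ~~ up R y l) ->
  exists L, forall x, exists y, star L x y \/ star L y x.
Proof.
case=> l lr leaf; have [L LP] := up_kernel; exists L => x.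
have [Lx|Lx] := boolP (L x).
  have xr : x != root R.
    apply: contraTneq Lx => ->; rewrite LP; apply/forallPn; exists l.
    by rewrite lr negbK LP; apply/forallP=> y; rewrite (negbTE (leaf y)).
  exists (par R x); right; rewrite /star up_par // Lx LP.
  by apply/forallPn; exists x; rewrite up_par // Lx.
move: (Lx); rewrite LP => /forallPn[y].
rewrite negb_imply negbK => /andP[yx Ly].
by exists y; left; rewrite /star yx Ly.
Qed.

End Stars.

(** Rooting at the neighbour of a leaf makes that leaf a childless child of the root, as
    [star_cover] requires. *)
Lemma tree_star (T : sgraph) : is_tree T -> 1 < #|T| ->
  exists (R : rooting T) (L : pred T),
    forall x, exists y, star R L x y \/ star R L y x.
Proof.
move=> tT T1; have [l [r lr] leaf] := tree_leaf tT T1.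
have [R rR] := tree_rooting r tT; exists R; apply: star_cover.
have ur : up R l r.
  move: lr; rewrite (adj_up R) => /orP[] // /up_spec[].
  by rewrite rR eqxx.
exists l; first by rewrite rR.
move=> y; apply/negP=> yl; have ly : adj l y by rewrite (adj_up R) yl orbT.
by move: (upP yl); rewrite (leaf _ _ ly lr) (upP ur); lia.
Qed.

(** * The orientation of the product and its basic routes *)

Section Product.

Variables (T1 T2 : sgraph) (R1 : rooting T1) (R2 : rooting T2) (L : pred T1).

Definition parity (s : T1 * T2) := odd (depth R1 s.1) (+) odd (depth R2 s.2).

Definition parc : rel (T1 * T2) := fun s t =>
  [|| (s.2 == t.2) &&
        (if odd (depth R2 s.2) then up R1 s.1 t.1 else up R1 t.1 s.1),
      (s.1 == t.1) && (odd (depth R2 s.2) (+) L s.1) && adj s.2 t.2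
    | adj s.1 t.1 && (if parity s then up R2 s.2 t.2 else up R2 t.2 s.2)].

(** Adjacent vertices of [T2] have depths of opposite parity, so an edge in a copy of [T2] gets one
    direction; the ends of a diagonal edge share their [parity] and thus agree on its direction. *)
Lemma parc_orientation s t :
  if strong_adj s t then parc s t (+) parc t s else ~~ parc s t.
Proof.
have irr (T : sgraph) (R : rooting T) x : up R x x = false.
  by apply/negP=> /upP; lia.
have exor (T : sgraph) (R : rooting T) x y : adj x y -> up R x y = ~~ up R y x.
  rewrite (adj_up R) => /orP[] h; rewrite h.
    by rewrite (up_asym h).
  by rewrite (up_asym h).
case: s t => [x y] [x' y']; rewrite /strong_adj /parc /parity /=.
rewrite (eq_sym x') (eq_sym y') (adj_sym x') (adj_sym y').
have [<-|xx] := eqVneq x x'; have [<-|yy] := eqVneq y y';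
  rewrite ?adj_irr ?irr ?if_same //=.
- by rewrite andbF.
- rewrite !orbF; case: ifP => [yy'|->]; last by rewrite andbF.
  by rewrite yy' (odd_adj R2 yy') !andbT; case: odd; case: L.
- rewrite !andbT !andbF !orbF; case: ifP => [xx'|xx'].
    by rewrite (exor _ _ _ _ xx'); case: odd; case: up.
  by move: xx'; rewrite (adj_up R1); case: odd; case: up => //; case: up.
- rewrite andbF /=; case: ifP => [/andP[xx' yy']|]; last first.
    case: (adj x x') => //=; rewrite (adj_up R2).
    by case: ifP; case: up => //; case: up.
  rewrite xx' (odd_adj R1 xx') (odd_adj R2 yy') (exor _ _ _ _ yy') /=.
  by case: odd; case: odd; case: up.
Qed.


(** A diagonal step changes both depths by one, so [parity] persists and the climb can go on. *)
Lemma reach_diag_up k x y x' : parity (x, y) -> k <= depth R2 y ->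
  walk (@adj T1) k x x' -> reach parc k (x, y) (x', iter k (par R2) y).
Proof.
elim: k => [|k IH] in x y * => pxy ky /=; first by move=> ->; exists 0.
case=> z xz zx'; have yr : y != root R2 by rewrite -depth_gt0; lia.
rewrite -iterS iterSr -add1n; apply: (@reach_trans _ _ _ _ _ (z, par R2 y)).
  by apply: reach1; rewrite /parc /= xz pxy up_par // !orbT.
have dy := depth_par yr; apply: IH => //; last by lia.
move: pxy; rewrite /parity /= dy (odd_adj R1 xz) /=.
by case: odd; case: odd.
Qed.

Lemma reach_diag_down k x y x' : ~~ parity (x, y) -> k <= depth R2 y ->
  walk (@adj T1) k x' x -> reach parc k (x', iter k (par R2) y) (x, y).
Proof.
elim: k => [|k IH] in x y * => pxy ky; first by move=> /= ->; exists 0.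
move=> /(walk_sym (@adj_sym T1))[z xz zx'].
have yr : y != root R2 by rewrite -depth_gt0; lia.
have dy := depth_par yr; have pz : ~~ parity (z, par R2 y).
  move: pxy; rewrite /parity /= dy (odd_adj R1 xz) /=.
  by case: odd; case: odd.
rewrite iterSr -addn1; apply: (@reach_trans _ _ _ _ _ (z, par R2 y)).
  by apply: IH => //; [lia | exact: walk_sym (@adj_sym T1) zx'].
by apply: reach1; rewrite /parc /= (adj_sym z) xz (negbTE pz) up_par // !orbT.
Qed.

Lemma reach_up k x y : odd (depth R2 y) -> k <= depth R1 x ->
  reach parc k (x, y) (iter k (par R1) x, y).
Proof.
move=> oy; elim: k => [|k IH] kx; first by exists 0.
rewrite -addn1; apply: reach_trans (IH (ltnW kx)) _; apply: reach1.
by rewrite /parc /= addn1 eqxx oy up_par ?iter_par_nroot.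
Qed.

Lemma reach_down k x y : ~~ odd (depth R2 y) -> k <= depth R1 x ->
  reach parc k (iter k (par R1) x, y) (x, y).
Proof.
move=> oy; elim: k => [|k IH] kx; first by exists 0.
rewrite -add1n; apply: reach_trans (IH (ltnW kx)); apply: reach1.
by rewrite /parc /= eqxx (negbTE oy) up_par ?iter_par_nroot.
Qed.

(* The arcs (u, e) -> (l, e) -> (l, o) -> (u, o) -> (u, e), where e is the end
   of even depth of the edge of T2 and o the end of odd depth. *)
Lemma reach_cell u l y y' : star R1 L u l -> adj y y' ->
  forall x x' z z', (x == u) || (x == l) -> (x' == u) || (x' == l) ->
    (z == y) || (z == y') -> (z' == y) || (z' == y') ->
  reach parc 3 (x, z) (x', z').
Proof.
move=> /and3P[lu Ll Lu] yy'.
wlog oy : y y' yy' / odd (depth R2 y') => [IH x x' z z' xP x'P zP z'P|].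
  have [oy'|oy'] := boolP (odd (depth R2 y')); first exact: (IH y y').
  rewrite adj_sym in yy'; apply: (IH y' y) => //; rewrite ?(orbC (_ == y')) //.
  by rewrite (odd_adj R2 yy') oy'.
have ey : odd (depth R2 y) = false.
  by rewrite (odd_adj R2 (x := y')) ?oy // adj_sym.
have a1 : parc (u, y) (l, y) by rewrite /parc /= eqxx ey lu.
have a2 : parc (l, y) (l, y') by rewrite /parc /= eqxx ey Ll yy' !orbT.
have a3 : parc (l, y') (u, y') by rewrite /parc /= eqxx oy lu.
have a4 : parc (u, y') (u, y).
  by rewrite /parc /= eqxx oy (negbTE Lu) adj_sym yy' !orbT.
(* Three consecutive arcs visit the whole cycle; the four rotations cover all starting vertices. *)
have arc3 s1 s2 s3 s4 : parc s1 s2 -> parc s2 s3 -> parc s3 s4 ->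
    [/\ reach parc 3 s1 s1, reach parc 3 s1 s2, reach parc 3 s1 s3
      & reach parc 3 s1 s4].
  move=> s12 s23 s34; split; first by exists 0.
  - by exists 1 => //; exists s2.
  - by exists 2 => //; exists s2 => //; exists s3.
  - by exists 3 => //; exists s2 => //; exists s3 => //; exists s4.
have [? ? ? ?] := arc3 _ _ _ _ a1 a2 a3.
have [? ? ? ?] := arc3 _ _ _ _ a2 a3 a4.
have [? ? ? ?] := arc3 _ _ _ _ a3 a4 a1.
have [? ? ? ?] := arc3 _ _ _ _ a4 a1 a2.
by move=> x x' z z' /orP[] /eqP-> /orP[] /eqP-> /orP[] /eqP-> /orP[] /eqP->.
Qed.

(** * Routing between arbitrary vertices *)

Hypothesis stars : forall x, exists x', star R1 L x x' \/ star R1 L x' x.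
Hypothesis nbrs2 : forall y : T2, exists y', adj y y'.

Lemma star_nbr x : exists x', adj x x' /\
  forall y y', adj y y' -> forall a b c d,
    (a == x) || (a == x') -> (b == x) || (b == x') ->
    (c == y) || (c == y') -> (d == y) || (d == y') ->
  reach parc 3 (a, c) (b, d).
Proof.
have [x' [s|s]] := stars x; exists x'; split.
- by case/and3P: s => s _ _; rewrite (adj_up R1) s orbT.
- by move=> y y' yy' a b c d; apply: reach_cell s yy' _ _ _ _.
- by case/and3P: s => s _ _; rewrite (adj_up R1) s.
- move=> y y' yy' a b c d; rewrite (orbC (a == x)) (orbC (b == x)).
  exact: reach_cell s yy' _ _ _ _.
Qed.

Lemma reach_vert x y y' : adj y y' -> reach parc 3 (x, y) (x, y').
Proof.
move=> yy'; have [x' [_ h]] := star_nbr x.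
by apply: (h _ _ yy'); rewrite eqxx ?orbT.
Qed.

(* Two adjacent turning points near the meeting point: the ascent ends at odd
   depth and the descent starts at even depth. *)
Lemma turn i j y y' : y != root R2 -> meet R2 i j y y' ->
  exists a b, [/\ a <= depth R2 y, b <= depth R2 y', a + b <= i + j + 1,
    odd (depth R2 (iter a (par R2) y)) /\ ~~ odd (depth R2 (iter b (par R2) y'))
    & adj (iter a (par R2) y) (iter b (par R2) y')].
Proof.
move=> yr [iy jy' ij]; set z := iter i _ _ in ij.
have dz : depth R2 z = depth R2 y - i by rewrite depth_iter_par.
have dz' : depth R2 z = depth R2 y' - j by rewrite ij depth_iter_par.
(* The root has even depth and no parent, so the ascent stops one level below it; [i] is positive
   because [y] is not the root. *)
have [zr|zr] := eqVneq z (root R2).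
  rewrite -depth_gt0 in yr; rewrite zr depth_root in dz.
  have i1 : i = i.-1.+1 by lia.
  have nr : iter i.-1 (par R2) y != root R2 by apply: iter_par_nroot; lia.
  have zE : z = par R2 (iter i.-1 (par R2) y) by rewrite -iterS -i1.
  have az := adj_par_l nr; rewrite -zE in az.
  exists i.-1, j; rewrite -ij; split; rewrite ?zr ?depth_root //; try lia.
    split=> //; rewrite -[odd _]negbK -(odd_adj R2 az) zr depth_root //.
  by rewrite -zr.
(* Otherwise [z] and its parent are the turning points, ordered by the parity of the depth of
   [z]. *)
have az := adj_par_l zr; rewrite -depth_gt0 in zr.
have [oz|oz] := boolP (odd (depth R2 z)).
  exists i, j.+1; rewrite iterS -ij -/z; split; try lia => //.
  by rewrite (odd_adj R2 az) oz.
exists i.+1, j; rewrite iterS -ij -/z; split; try lia.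
  by rewrite (odd_adj R2 az) oz.
by rewrite adj_sym.
Qed.

Lemma reach_core i1 j1 i2 j2 x y x' y' :
    parity (x, y) -> ~~ parity (x', y') -> y != root R2 ->
    meet R1 i1 j1 x x' -> meet R2 i2 j2 y y' ->
  reach parc (maxn (i1 + j1) (i2 + j2 + 1) + 3) (x, y) (x', y').
Proof.
move=> pxy pxy' yr m1 m2.
have [a [b [ay by' abn [oa ob] adz]]] := turn yr m2.
have nbrs1 (u : T1) : exists v, adj u v by have [v []] := star_nbr u; exists v.
(* Modulo 2, [a] is the depth of [x] and [b] that of [x']. *)
have oab : odd (a + b) = odd (i1 + j1).
  rewrite (meet_odd m1) oddD; move: pxy pxy' oa ob; rewrite /parity /=.
  rewrite !depth_iter_par // !oddB //.
  by do 2!case: (odd (depth R2 _)); do 2!case: (odd (depth R1 _));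
    case: (odd a); case: (odd b).
have [u [v [k [l [wu wv [ku lv kl] le]]]]] := meet_split nbrs1 m1 oab.
apply: (@reach_leq _ _ (a + (k + (3 + (l + b))))); first by lia.
apply: reach_trans (reach_diag_up pxy ay wu) _.
apply: reach_trans (reach_up oa ku) _.
apply: reach_trans (reach_vert _ adz) _; rewrite kl.
apply: reach_trans (reach_down ob lv) _.
exact: reach_diag_down pxy' by' wv.
Qed.

(** Choosing between [x] and a star neighbour fixes the parity; replacing [y] by a neighbour avoids
    the root, as [turn] demands. *)
Lemma start_cell x y : exists a c, [/\ parity (a, c), c != root R2,
  reach (@adj T1) 1 a x, reach (@adj T2) 1 c y & reach parc 3 (x, y) (a, c)].
Proof.
have [x' [xx' h]] := star_nbr x.
have [y' yy'] : exists y', adj y y' by exact: nbrs2.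
have [c [cr cy cy']] : exists c,
    [/\ c != root R2, reach (@adj T2) 1 c y & (c == y) || (c == y')].
  have [yr|yr] := eqVneq y (root R2); last first.
    by exists y; split; rewrite ?eqxx //; exists 0.
  exists y'; split; rewrite ?eqxx ?orbT //.
    2: by apply: reach1; rewrite adj_sym.
  by rewrite -yr; apply: contraTneq yy' => ->; rewrite adj_irr.
have [pc|pc] := boolP (parity (x, c)).
  exists x, c; split=> //; first by exists 0.
  by apply: (h _ _ yy'); rewrite ?eqxx.
exists x', c; split=> //; last by apply: (h _ _ yy'); rewrite ?eqxx ?orbT.
  by move: pc; rewrite /parity /= (odd_adj R1 xx'); case: odd; case: odd.
by apply: reach1; rewrite adj_sym.
Qed.

Lemma end_cell x y : exists a,
  [/\ ~~ parity (a, y), reach (@adj T1) 1 x a & reach parc 3 (a, y) (x, y)].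
Proof.
have [x' [xx' h]] := star_nbr x; have [y' yy'] := nbrs2 y.
have [px|px] := boolP (parity (x, y)); last first.
  by exists x; split; [|exists 0|exists 0].
exists x'; split; last by apply: (h _ _ yy'); rewrite ?eqxx ?orbT.
  by move: px; rewrite /parity /= (odd_adj R1 xx'); case: odd; case: odd.
exact: reach1.
Qed.

(** The cells at the start, the turn and the end cost 3 each. The shifted ends add at most 2 to the
    distance in [T1]; in [T2] the shift and the turn add 1 each. Hence 9 + 2 = 11. *)
Lemma reach_product d1 d2 x y x' y' :
    reach (@adj T1) d1 x x' -> reach (@adj T2) d2 y y' ->
  reach parc (maxn d1 d2 + 11) (x, y) (x', y').
Proof.
move=> r1 r2; have [a [c [pac cr ax cy xa]]] := start_cell x y.
have [b [pb xb bx]] := end_cell x' y'.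
have [n1 le1 /(walk_meet R1)[i1 [j1 [ij1 m1]]]] :=
  reach_trans (reach_trans ax r1) xb.
have [n2 le2 /(walk_meet R2)[i2 [j2 [ij2 m2]]]] := reach_trans cy r2.
have core := reach_core pac pb cr m1 m2.
apply: reach_leq (reach_trans (reach_trans xa core) bx); lia.
Qed.

End Product.

(* If exactly one tree is a single vertex, the product is a nontrivial tree,
   which has no strong orientation; the hypothesis on cardinals excludes
   precisely this case, where diam_min is the minimum of an empty set. *)
Theorem theorem3p1 (T1 T2 : sgraph) (tree1 : is_tree T1) (tree2 : is_tree T2)
    (triv : #|T1| = 1 <-> #|T2| = 1) :
  ole (diam_min (strong_product T1 T2)) (oaddn (omax (diam T1) (diam T2)) 15).
Proof.
have oleN a : ole a None by case: a.
case d1E: (diam T1) => [d1|]; last exact: oleN.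
case d2E: (diam T2) => [d2|]; last exact: oleN.
have r1 : forall x y, reach (@adj T1) d1 x y.
  by apply/rdiam_reach; rewrite -/(diam T1) d1E /=.
have r2 : forall x y, reach (@adj T2) d2 x y.
  by apply/rdiam_reach; rewrite -/(diam T2) d2E /=.
have [c1 _ _] := tree1; have [c2 _ _] := tree2.
have [T1_1|T1_n1] := eqVneq #|T1| 1.
  have T2_1 := triv.1 T1_1.
  have sub (T : finType) (x y : T) : #|T| = 1 -> x = y.
    move=> c; have /card_le1_eqP h : #|T| <= 1 by rewrite c.
    exact: h.
  (* The product is a single vertex, oriented by the empty arc set. *)
  apply: (@diam_min_reach _ (fun _ _ => false)) => -[x y] [x' y'].
    by rewrite (sub _ x x') // (sub _ y y') // adj_irr.
  by exists 0; rewrite // (sub _ x x') // (sub _ y y').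
have T2_n1 : #|T2| != 1 by apply: contra_neq T1_n1 => /triv.
have T1_gt1 : 1 < #|T1| by rewrite ltn_neqAle eq_sym T1_n1.
have [R1 [L stars]] := tree_star tree1 T1_gt1.
have T2_gt1 : 1 < #|T2| by rewrite ltn_neqAle eq_sym T2_n1.
have /card_gt0P[r _] := c2; have [R2 _] := tree_rooting r tree2.
apply: (@diam_min_reach (strong_product T1 T2) (parc R1 R2 L)).
  exact: parc_orientation.
move=> [x y] [x' y']; have nbrs2 z := tree_nbr z tree2 T2_gt1.
apply: (@reach_leq _ _ (maxn d1 d2 + 11)); first by lia.
exact (reach_product R2 stars nbrs2 (r1 x x') (r2 y y')).
Qed.
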